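(* Let $n$ be a positive integer and let $H = (V, A, B)$ be an $n$-uniform cross-intersecting family with $\min(|A|, |B|) \geq 3$. Then $\chi(H) \leq 3$.
   Context: A hypergraph is a pair $(V,E)$ where $V$ is a set of vertices and $E$ is a set of subsets of $V$ (edges); it is $n$-uniform if every edge has exactly $n$ vertices. A cross-intersecting family $H = (V, A, B)$ is a hypergraph with vertex set $V$ and edge set $A \cup B$, where $A$ and $B$ are non-empty (not necessarily disjoint) sets of edges such that $a \cap b \neq \emptyset$ for every $a \in A$ and $b \in B$. A coloring of the vertices is proper if no edge of $A \cup B$ is monochromatic; the chromatic number $\chi(H)$ is the minimal number of colors in a proper coloring. *)

(* Defs.v *)
From mathcomp Require Import all_boot.
From mathcomp Require Import boolp classical_sets functions cardinality.

Set Implicit Arguments.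
Unset Strict Implicit.
Unset Printing Implicit Defensive.

Local Open Scope classical_set_scope.
Local Open Scope card_scope.

(* The vertex set is the whole type V, which may be infinite; a hypergraph on V
   is given by its set of edges. *)
Record hypergraph (V : Type) := Hypergraph { edges : set (set V) }.

Definition is_uniform (V : Type) (n : nat) (H : hypergraph V) : Prop :=
  forall e, edges H e -> e #= `I_n.

Record cross_family (V : Type) := CrossFamily {
  famA : set (set V);
  famB : set (set V);
  famA_neq0 : famA !=set0;
  famB_neq0 : famB !=set0;
  cross_intersect : forall a b, famA a -> famB b -> a `&` b !=set0
}.

Definition cross_hypergraph (V : Type) (H : cross_family V) : hypergraph V :=
  Hypergraph (famA H `|` famB H).

Coercion cross_hypergraph : cross_family >-> hypergraph.

Definition monochromatic (V C : Type) (f : V -> C) (e : set V) : Prop :=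
  exists c, forall x, e x -> f x = c.

Definition proper_coloring (V C : Type) (H : hypergraph V) (f : V -> C) : Prop :=
  forall e, edges H e -> ~ monochromatic f e.

Definition colorable (V : Type) (H : hypergraph V) (k : nat) : Prop :=
  exists f : V -> 'I_k, proper_coloring H f.

(* A relation rather than a function: a hypergraph may have no proper coloring
   with finitely many colors (e.g. when some edge is a singleton), and then no k
   is its chromatic number. *)
Definition is_chromatic_number (V : Type) (H : hypergraph V) (k : nat) : Prop :=
  colorable H k /\ forall j, colorable H j -> k <= j.

(* Main.v *)
(** Take [a] in [A], [b] in [B] and [x] in [a], and color [a \ x], [x + (b \ a)]
    and the rest with three different colors. The first class is too small to
    contain an edge and the last one misses [a] or [b], so failure yields an edge
    inside [x + (b \ a)].
    If [a] and [b] share two points, choosing [x] among them excludes this.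
    Otherwise [a] and [b] always share exactly one point [z], and then
    [x + (b \ z)] and, symmetrically, [y + (a \ z)] are edges for [x <> z] in [a]
    and [y <> z] in [b]. For [n >= 3] the first must lie in [B] and the second in
    [A], yet they share [x] and [y]. For [n = 2] there is a triangle with edges
    in both families, which leaves no room for three edges in each. *)

Require Import Defs.
From mathcomp Require Import all_boot.
From mathcomp Require Import finmap.
From mathcomp Require Import boolp classical_sets functions cardinality.

Set Implicit Arguments.
Unset Strict Implicit.

Local Open Scope classical_set_scope.
Local Open Scope card_scope.

(** * Cardinality of finite sets *)

Lemma card_gt_enum (T : Type) (n : nat) (f : nat -> T) (S : set T) :
  `I_n.+1 #<= S -> exists2 z, S z & forall i, i < n -> z <> f i.
Proof.
move=> cS; apply: contrapT => nz.
have Sf : S `<=` f @` `I_n.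
  move=> z Sz; apply: contrapT => zf; apply: nz; exists z => // i ilt zfi.
  by apply: zf; exists i.
have := card_le_trans cS (card_le_trans (subset_card_le Sf) (card_image_le f _)).
by rewrite card_le_II ltnn.
Qed.

Lemma card_ge2_neq (T : Type) (x : T) (S : set T) :
  `I_2 #<= S -> exists2 z, S z & z <> x.
Proof. by move=> /(@card_gt_enum _ _ (fun=> x))[z Sz /(_ 0 isT)]; exists z. Qed.

Lemma card_ge3_neq (T : Type) (x y : T) (S : set T) :
  `I_3 #<= S -> exists z, [/\ S z, z <> x & z <> y].
Proof.
move=> /(@card_gt_enum _ _ (fun i => if i is 0 then x else y))[z Sz zf].
by exists z; split; [|exact: (zf 0)|exact: (zf 1)].
Qed.

Lemma sub_card_eq (T : Type) (n : nat) (e f : set T) :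
  e #= `I_n -> f #= `I_n -> e `<=` f -> e = f.
Proof.
(* Finite sets in the sense of [fset_set] need a choice type; [{classic T}] supplies one on [T]. *)
move=> en fn ef; pose T' : choiceType := {classic T}.
have fe : finite_set (e : set T') by apply/finite_setP; exists n.
have ff : finite_set (f : set T') by apply/finite_setP; exists n.
have ce : #|` fset_set (e : set T')| = n by apply: card_fset_set.
have cf : #|` fset_set (f : set T')| = n by apply: card_fset_set.
apply: (@fset_set_inj T') => //.
by apply/eqP; rewrite eqEfcard ce cf leqnn andbT -fset_set_sub.
Qed.

Lemma card_swap (T : Type) (n : nat) (b : set T) (x z : T) :
  b #= `I_n -> b z -> ~ b x -> x |` (b `\ z) #= `I_n.
Proof.
(* Replacing [z] by [x] is injective on [b] because [x] lies outside [b]. *)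
move=> bn bz bx; pose f t := if `[< t = z >] then x else t.
have -> : x |` (b `\ z) = f @` b.
  apply/seteqP; split => t /=.
    move=> [->|[bt tz]]; first by exists z; rewrite /f ?asboolT.
    by exists t; rewrite /f ?asboolF.
  move=> [u bu <-]; rewrite /f; case: asboolP => [_|uz]; first by left.
  by right.
apply: card_eq_trans bn; apply: inj_card_eq => s t.
rewrite !inE /f => bs bt; case: asboolP => [->|sz]; case: asboolP => [->|tz] //.
  by move=> xt; case: bx; rewrite xt.
by move=> sx; case: bx; rewrite -sx.
Qed.

(** * Edges forced by the failure of three colors *)

(** The color classes are [X], [Y] minus [X], and the complement of both. A monochromatic edge would
    lie in [X], lie in [Y], or miss their union. *)
Lemma colorable3 (V : Type) (H : hypergraph V) (X Y : set V) :
  (forall e, edges H e -> ~ e `<=` X) ->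
  (forall e, edges H e -> ~ e `<=` Y) ->
  (forall e, edges H e -> e `&` (X `|` Y) !=set0) -> colorable H 3.
Proof.
move=> nX nY nZ.
pose f v : 'I_3 :=
  if `[< X v >] then inord 0 else if `[< Y v >] then inord 1 else inord 2.
have val_f v : f v =
    (if `[< X v >] then 0 else if `[< Y v >] then 1 else 2) :> nat.
  by rewrite /f; case: asboolP => _; [|case: asboolP => _]; rewrite inordK.
exists f => e He [c ec].
have {}ec v : e v ->
    (if `[< X v >] then 0 else if `[< Y v >] then 1 else 2) = c.
  by move=> ev; rewrite -val_f ec.
have [v [ev XYv]] := nZ e He.
have [Xv|nXv] := pselect (X v).
  apply: (nX e He) => w /ec.
  by rewrite -(ec v ev) (asboolT Xv); case: asboolP => // _; case: asboolP.
have Yv : Y v by case: XYv.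
case: (nY e He) => w /ec; rewrite -(ec v ev) (asboolF nXv) (asboolT Yv).
by case: asboolP => // _; case: asboolP.
Qed.

(** In [colorable3] with [X = a \ x] and [Y = x + (b \ a)], the set [X] is too small for an edge and
    the union of [X] and [Y] is that of [a] and [b], so only the condition on [Y] can fail. *)
Lemma not_colorable3_edge (V : Type) (n : nat) (H : hypergraph V) (a b : set V)
    (x : V) :
  is_uniform n H -> ~ colorable H 3 -> edges H a ->
  (forall e, edges H e -> e `&` (a `|` b) !=set0) -> a x ->
  exists2 e, edges H e & e `<=` x |` (b `\` a).
Proof.
move=> unifH ncol Ha Hab ax; apply: contrapT => ne; apply: ncol.
apply: (@colorable3 _ _ (a `\ x) (x |` (b `\` a))).
- move=> e He eax.
  have ea : e = a.
    by apply: sub_card_eq (unifH _ He) (unifH _ Ha) _ => t /eax[].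
  by have := ax; rewrite -ea => /eax[_]; apply.
- by move=> e He esub; apply: ne; exists e.
- move=> e He; have [t [et abt]] := Hab e He; exists t; split => //.
  have [->|tx] := pselect (t = x); first by right; left.
  have [at_|nat_] := pselect (a t); first by left.
  by right; right; split => //; case: abt.
Qed.

Lemma cross_transversal (V : Type) (H : cross_family V) (a b e : set V) :
  famA H a -> famB H b -> edges H e -> e `&` (a `|` b) !=set0.
Proof.
move=> Aa Bb [Ae|Be].
  by have [t [et bt]] := cross_intersect Ae Bb; exists t; split => //; right.
by have [t [at_ et]] := cross_intersect Aa Be; exists t; split => //; left.
Qed.

(** For [p] in both edges, the forced edge inside [p + (b \ a)] lies in [b], hence is [b]; but a
    second common point [q] is missing from it. *)
Lemma cross_linear (V : Type) (n : nat) (H : cross_family V) (a b : set V)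
    (p q : V) :
  is_uniform n H -> ~ colorable H 3 -> famA H a -> famB H b ->
  a p -> b p -> a q -> b q -> p = q.
Proof.
move=> unifH ncol Aa Bb ap bp aq bq; apply: contrapT => pq.
have [e He esub] := not_colorable3_edge unifH ncol (or_introl Aa)
  (fun e => cross_transversal Aa Bb) ap.
have eb : e = b.
  apply: sub_card_eq (unifH _ He) (unifH _ (or_intror Bb)) _ => t /esub.
  by move=> [->|[]].
by have := bq; rewrite -eb => /esub[/esym|[]].
Qed.

(** Here [b \ a] is [b \ z], so the set containing the forced edge has exactly [n] points and is
    that edge. The families are not mentioned, so that [a] and [b] can exchange roles. *)
Lemma swap_edge (V : Type) (n : nat) (H : hypergraph V) (a b : set V) (x z : V) :
  is_uniform n H -> ~ colorable H 3 -> edges H a -> edges H b ->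
  (forall e, edges H e -> e `&` (a `|` b) !=set0) ->
  (forall t, a t -> b t -> t = z) -> a z -> b z -> a x -> x <> z ->
  edges H (x |` (b `\ z)).
Proof.
move=> unifH ncol Ha Hb Hab abz az bz ax xz.
have [e He esub] := not_colorable3_edge unifH ncol Ha Hab ax.
suff <- : e = x |` (b `\ z) by [].
apply: sub_card_eq (unifH _ He) _ _.
  by apply: card_swap (unifH _ Hb) bz _ => bx; apply/xz/abz.
by move=> t /esub[->|[bt nat_]]; [left|right; split => // tz; rewrite tz in nat_].
Qed.

(** * Uniformity at least three *)

Lemma not_colorable3_le2 (V : Type) (n : nat) (H : cross_family V) :
  is_uniform n H -> ~ colorable H 3 -> ~ (`I_3 #<= `I_n).
Proof.
move=> unifH ncol n3.
have card_ge3 e : edges H e -> `I_3 #<= e.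
  by move=> He; rewrite (card_le_eqr (unifH _ He)).
have [a Aa] := famA_neq0 H; have [b Bb] := famB_neq0 H.
have Ha : edges H a by left.
have Hb : edges H b by right.
have [z [az bz]] := cross_intersect Aa Bb.
have abz t : a t -> b t -> t = z.
  by move=> at_ bt; apply: cross_linear unifH ncol Aa Bb _ _ _ _.
have Hab := fun e => @cross_transversal _ H a b e Aa Bb.
have [x [ax xz _]] := card_ge3_neq z z (card_ge3 a Ha).
have [y [by_ yz _]] := card_ge3_neq z z (card_ge3 b Hb).
have xy : x <> y by move=> xy; apply/xz/abz; rewrite // xy.
have Hf := swap_edge unifH ncol Ha Hb Hab abz az bz ax xz.
have Hg : edges H (y |` (a `\ z)).
  apply: swap_edge unifH ncol Hb Ha _ _ bz az by_ yz; first by rewrite setUC.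
  by move=> t bt at_; exact: abz.
(* Were this edge in [A], it would share with [b] the two points [y] and [w], against
   [cross_linear]. *)
have Bf : famB H (x |` (b `\ z)).
  case: Hf => // Af; have [w [bw wz wy]] := card_ge3_neq z y (card_ge3 b Hb).
  by case: wy; apply: cross_linear unifH ncol Af Bb _ _ _ _ => //; right.
have Ag : famA H (y |` (a `\ z)).
  case: Hg => // Bg; have [w [aw wz wx]] := card_ge3_neq z x (card_ge3 a Ha).
  by case: wx; apply: cross_linear unifH ncol Aa Bg _ _ _ _ => //; right.
(* The edges from [Ag] and [Bf] both contain [x] and [y]. *)
by apply: xy; apply: cross_linear unifH ncol Ag Bf _ _ _ _; by [left|right].
Qed.

(** * Uniformity one and two *)

Lemma card_set2 (T : Type) (p q : T) : p <> q -> [set p; q] #= `I_2.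
Proof.
move=> pq; pose f i := if i is 0 then p else q.
have -> : [set p; q] = f @` `I_2.
  apply/seteqP; split => t /=; first by move=> [->|->]; [exists 0|exists 1].
  by move=> [[|i] _ <-]; [left|right].
by apply: inj_card_eq => -[|[|i]] [|[|j]]; rewrite !inE //= => _ _ /esym.
Qed.

Lemma card2_eq (T : Type) (e : set T) (p q : T) :
  e #= `I_2 -> e p -> e q -> p <> q -> e = [set p; q].
Proof.
move=> e2 ep eq_ pq; apply/esym/(sub_card_eq (card_set2 pq) e2).
by move=> t [->|->].
Qed.

(** Two further edges of [B] must pass through [x], with other ends [u] and [v] outside the
    triangle. A third edge of [A] avoids [x], so it is [{u, v}] and misses [{y, z}]. Arbitrary [A]
    and [B] allow exchanging the two families. *)
Lemma linear_triangle (V : Type) (A B : set (set V)) (x y z : V) :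
  (forall a, A a -> a #= `I_2) -> (forall b, B b -> b #= `I_2) ->
  (forall a b, A a -> B b -> a `&` b !=set0) -> (forall e, A e -> ~ B e) ->
  `I_3 #<= A -> `I_3 #<= B -> x <> y -> x <> z -> y <> z ->
  A [set x; z] -> A [set x; y] -> B [set y; z] -> False.
Proof.
move=> A2 B2 AB dAB A3 B3 xy xz yz Axz Axy Byz.
(* Without [x], the edge meets [{x, z}] in [z] and [{x, y}] in [y]. *)
have Bx b : B b -> b <> [set y; z] -> b x.
  move=> Bb bn; apply: contrapT => bx; apply: bn.
  have [t [txz bt]] := AB _ _ Axz Bb; have [s [sxy bs]] := AB _ _ Axy Bb.
  apply: card2_eq (B2 _ Bb) _ _ yz.
    by case: sxy => /= sE; rewrite sE in bs.
  by case: txz => /= tE; rewrite tE in bt.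
have nB b u : B b -> b x -> b u -> u = y \/ u = z -> False.
  move=> Bb bx bu [] uE; rewrite {}uE in bu.
    by apply: dAB Axy _; rewrite -(card2_eq (B2 _ Bb) bx bu xy).
  by apply: dAB Axz _; rewrite -(card2_eq (B2 _ Bb) bx bu xz).
have [b1 [B1 b1n _]] := card_ge3_neq [set y; z] [set y; z] B3.
have [b2 [B2' b2n b21]] := card_ge3_neq [set y; z] b1 B3.
have b1x := Bx _ B1 b1n; have b2x := Bx _ B2' b2n.
have [a [Aa axz axy]] := card_ge3_neq [set x; z] [set x; y] A3.
have [w [aw wyz]] := AB _ _ Aa Byz.
(* Since [a] meets [{y, z}], containing [x] would make it one of the two known edges of [A]. *)
have [ax|nax] := pselect (a x).
  by case: wyz => /= wE; rewrite wE in aw;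
    [apply/axy/card2_eq|apply/axz/card2_eq] => //; exact: A2.
have [u [au b1u]] := AB _ _ Aa B1; have [v [av b2v]] := AB _ _ Aa B2'.
have xu : x <> u by move=> xu; rewrite xu in nax.
have xv : x <> v by move=> xv; rewrite xv in nax.
have uv : u <> v.
  move=> uv; apply: b21; rewrite (card2_eq (B2 _ B1) b1x b1u xu).
  by rewrite (card2_eq (B2 _ B2') b2x b2v xv) uv.
have := aw; rewrite (card2_eq (A2 _ Aa) au av uv) => -[] /= wE.
  by rewrite wE in wyz; exact: nB B1 b1x b1u wyz.
by rewrite wE in wyz; exact: nB B2' b2x b2v wyz.
Qed.

(** Singletons that meet coincide, so every edge of [A] equals a fixed edge of [B]. *)
Lemma cross_uniform1_le1 (V : Type) (H : cross_family V) :
  is_uniform 1 H -> ~ (`I_2 #<= famA H).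
Proof.
move=> unifH A2; have [b Bb] := famB_neq0 H.
have Ab a : famA H a -> a = b.
  move=> Aa; have [t [at_ bt]] := cross_intersect Aa Bb.
  have eq_t e : edges H e -> e t -> [set t] = e.
    by move=> He et; apply: sub_card_eq card_set1 (unifH _ He) _ => s ->.
  by rewrite -(eq_t a) ?(eq_t b) //; [right|left].
have [a Aa] := famA_neq0 H.
by have [a' Aa' a'a] := card_ge2_neq a A2; case: a'a; rewrite (Ab _ Aa') (Ab _ Aa).
Qed.

Lemma cross_uniform2_colorable3 (V : Type) (H : cross_family V) :
  is_uniform 2 H -> `I_3 #<= famA H -> `I_3 #<= famB H -> colorable H 3.
Proof.
move=> unifH A3 B3; apply: contrapT => ncol.
have lin := cross_linear unifH ncol.
have A2 a : famA H a -> a #= `I_2 by move=> Aa; apply: unifH; left.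
have B2 b : famB H b -> b #= `I_2 by move=> Bb; apply: unifH; right.
have other e p : edges H e -> exists2 q, e q & q <> p.
  by move=> He; apply: card_ge2_neq; rewrite (card_le_eqr (unifH _ He)).
(* A common edge would meet itself in two points, against [lin]. *)
have dAB e : famA H e -> ~ famB H e.
  move=> Ae Be; have [p [ep _]] := cross_intersect Ae Be.
  have [q eq_ qp] := other e p (or_introl Ae).
  by apply: qp; exact: lin Ae Be _ _ _ _.
have [a Aa] := famA_neq0 H; have [b Bb] := famB_neq0 H.
have Ha : edges H a by left.
have Hb : edges H b by right.
have [z [az bz]] := cross_intersect Aa Bb.
have abz t : a t -> b t -> t = z by move=> at_ bt; apply: lin Aa Bb _ _ _ _.
have [x ax xz] := other a z Ha; have [y by_ yz] := other b z Hb.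
have xy : x <> y by move=> xy; apply/xz/abz; rewrite // xy.
have Hf : edges H [set x; y].
  have := swap_edge unifH ncol Ha Hb
    (fun e => @cross_transversal _ H a b e Aa Bb) abz az bz ax xz.
  by move=> Hf; rewrite -(card2_eq (unifH _ Hf) _ _ xy) //; [left|right].
have aE := card2_eq (A2 _ Aa) ax az xz; have bE := card2_eq (B2 _ Bb) by_ bz yz.
rewrite {}aE in Aa; rewrite {}bE in Bb.
(* The third side [{x, y}] lies in [A] or in [B]; the second case is the first with the families,
   and [x] and [y], exchanged. *)
case: Hf => Hf.
  exact: linear_triangle A2 B2 (@cross_intersect _ H) dAB A3 B3 xy xz yz Aa Hf Bb.
apply: linear_triangle B2 A2 _ _ B3 A3 (nesym xy) yz xz Bb _ Aa.
- by move=> b' a' Bb' Aa'; rewrite setIC; exact: cross_intersect Aa' Bb'.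
- by move=> e Be Ae; exact: dAB Ae Be.
- by rewrite setUC.
Qed.

(** * From colorability to the chromatic number *)

Lemma colorable_chromatic_number (V : Type) (H : hypergraph V) (m : nat) :
  colorable H m -> exists2 k, is_chromatic_number H k & k <= m.
Proof.
move=> /asboolP Hm; have ex : exists k, `[< colorable H k >] by exists m.
exists (ex_minn ex); case: ex_minnP => k /asboolP Hk kmin; last exact: kmin.
by split => // j /asboolP; exact: kmin.
Qed.

Theorem corollary1p7 (V : Type) (n : nat) (H : cross_family V)
  (n_gt0 : 0 < n) (unifH : is_uniform n H)
  (cardA : `I_3 #<= famA H) (cardB : `I_3 #<= famB H) :
  exists2 k : nat, is_chromatic_number H k & k <= 3.
Proof.
apply: colorable_chromatic_number.
(* The cases are [n = 1], which contradicts [cardA], then [n = 2], then [n >= 3]. *)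
case: n n_gt0 unifH => [//|[|[|n]]] _ unifH.
- case: (cross_uniform1_le1 unifH); apply: card_le_trans cardA.
  by rewrite card_le_II.
- exact: cross_uniform2_colorable3.
- apply: contrapT => ncol; apply: (not_colorable3_le2 unifH ncol).
  by rewrite card_le_II.
Qed.
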